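(* Let $q=p^h$ be an odd prime power ($p$ prime), where $h$ is an even positive integer. Let $0\leq e'\leq h-1$ be an integer such that $\frac{h}{\gcd(e',h)}$ is odd. Let $a_1,\dots,a_n$ be distinct elements of $\mathbb{F}_q$, $\boldsymbol{a}=(a_1,\dots,a_n)$, $\boldsymbol{v}=(v_1,\dots,v_n)\in(\mathbb{F}_q^* )^n$, and $u_i=\prod_{1\leq j\leq n,\,j\neq i}(a_i-a_j)^{-1}$ for $1\leq i\leq n$. Then the following hold. 1) Suppose $\mathrm{GRS}_m(\boldsymbol{a},\boldsymbol{v})\subseteq \mathrm{GRS}_m(\boldsymbol{a},\boldsymbol{v})^{\bot_{h/2}}$, and let $h(x)\in\mathbb{F}_q[x]$ be a monic polynomial with $\deg(h(x))\leq n-m-1$ such that, for some $\lambda\in\mathbb{F}_q^*$, $\lambda u_i h(a_i)=v_i^{\sqrt{q}+1}$ for all $1\leq i\leq n$ (such a polynomial exists because of the self-orthogonality). Then for every integer $k$ with $1\leq k\leq \left\lfloor \frac{p^{e'}+n-1-\deg(h(x))}{p^{e'}+1}\right\rfloor$ and every integer $l$ with $0\leq l\leq k$, there exists an $[n,k]_q$ MDS code $\mathcal{C}$ with $\dim(\mathrm{Hull}_{e'}(\mathcal{C}))=l$. 2) Suppose $\mathrm{GRS}_m(\boldsymbol{a},\boldsymbol{v},\infty)\subseteq \mathrm{GRS}_m(\boldsymbol{a},\boldsymbol{v},\infty)^{\bot_{h/2}}$ with $m\geq 2$, and let $h(x)\in\mathbb{F}_q[x]$ be a monic polynomial with $\deg(h(x))\leq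 n-m-1$ such that, for some $\lambda\in\mathbb{F}_q^*$, $\lambda u_i h(a_i)=v_i^{\sqrt{q}+1}$ for all $1\leq i\leq n$ (such a polynomial exists because of the self-orthogonality). Then for every integer $k$ with $1\leq k\leq \left\lfloor \frac{p^{e'}+n-1-\deg(h(x))}{p^{e'}+1}\right\rfloor$ and every integer $l$ with $0\leq l\leq k-1$, there exists an $[n+1,k]_q$ MDS code $\mathcal{C}$ with $\dim(\mathrm{Hull}_{e'}(\mathcal{C}))=l$.
   Context: For $q=p^h$ and an integer $0\leq e\leq h-1$, the $e$-Galois inner product of $\mathbf{c}_1=(c_{11},\dots,c_{1N})$ and $\mathbf{c}_2=(c_{21},\dots,c_{2N})$ in $\mathbb{F}_q^N$ is $(\mathbf{c}_1,\mathbf{c}_2)_e=\sum_{i=1}^N c_{1i}c_{2i}^{p^e}$. For a linear code $\mathcal{C}\subseteq\mathbb{F}_q^N$, its $e$-Galois dual is $\mathcal{C}^{\bot_e}=\{\mathbf{c}_1\in\mathbb{F}_q^N:(\mathbf{c}_1,\mathbf{c}_2)_e=0\text{ for all }\mathbf{c}_2\in\mathcal{C}\}$, and its $e$-Galois hull is $\mathrm{Hull}_e(\mathcal{C})=\mathcal{C}\cap\mathcal{C}^{\bot_e}$. (For $h$ even and $e=h/2$ this is the Hermitian case.) An $[N,k]_q$ code is a $k$-dimensional linear subspace of $\mathbb{F}_q^N$; it is MDS if its minimum Hamming distance is $N-k+1$. For distinct $a_1,\dots,a_n\in\mathbb{F}_q$, $\boldsymbol{v}\in(\mathbb{F}_q^*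 )^n$ and an integer $k\geq 0$: $\mathrm{GRS}_k(\boldsymbol{a},\boldsymbol{v})=\{(v_1f(a_1),\dots,v_nf(a_n)): f(x)\in\mathbb{F}_q[x],\ \deg(f(x))\leq k-1\}$ and $\mathrm{GRS}_k(\boldsymbol{a},\boldsymbol{v},\infty)=\{(v_1f(a_1),\dots,v_nf(a_n),f_{k-1}): f(x)\in\mathbb{F}_q[x],\ \deg(f(x))\leq k-1\}$, where $f_{k-1}$ is the coefficient of $x^{k-1}$ in $f(x)$. The polynomial $h(x)$ is unrelated to the exponent $h$ in $q=p^h$. Convention: $\gcd(0,h)=h$. *)

(* Defs.v *)
From HB Require Import structures.
From mathcomp Require Import all_boot all_order all_algebra all_field.

Set Implicit Arguments.
Unset Strict Implicit.
Unset Printing Implicit Defensive.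

Import GRing.Theory.
Local Open Scope ring_scope.

(* Linear codes of length N over F are the subspaces {vspace 'rV[F]_N}. *)

(* p is meant to be the characteristic of F. *)
Definition galois_inner (F : finFieldType) (N p e : nat) (c1 c2 : 'rV[F]_N) : F :=
  \sum_i c1 0 i * c2 0 i ^+ (p ^ e).

Definition galois_innerr (F : finFieldType) (N p e : nat) (c2 c1 : 'rV[F]_N) : F^o :=
  galois_inner p e c1 c2.

Fact galois_innerr_is_linear (F : finFieldType) (N p e : nat) (c2 : 'rV[F]_N) :
  linear (galois_innerr p e c2).
Proof.
move=> b x y; rewrite /galois_innerr /galois_inner /GRing.scale /= mulr_sumr.
by rewrite -big_split; apply: eq_bigr => i _; rewrite !mxE mulrDl mulrA.
Qed.

HB.instance Definition _ (F : finFieldType) (N p e : nat) (c2 : 'rV[F]_N) :=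
  GRing.isLinear.Build F 'rV[F]_N F^o *:%R (galois_innerr p e c2)
    (galois_innerr_is_linear p e c2).

Definition galois_dual (F : finFieldType) (N p e : nat) (C : {vspace 'rV[F]_N}) :
    {vspace 'rV[F]_N} :=
  (\bigcap_(c2 in C) lker (linfun (galois_innerr p e c2)))%VS.

Lemma galois_dualP (F : finFieldType) (N p e : nat) (C : {vspace 'rV[F]_N})
    (c1 : 'rV[F]_N) :
  reflect (forall c2, c2 \in C -> galois_inner p e c1 c2 = 0)
          (c1 \in galois_dual p e C).
Proof.
rewrite memvE; apply: (iffP subv_bigcapP) => H c2 /H.
  by rewrite -memvE memv_ker lfunE => /eqP.
by move=> E; rewrite -memvE memv_ker lfunE /= /galois_innerr E.
Qed.

Definition galois_hull (F : finFieldType) (N p e : nat) (C : {vspace 'rV[F]_N}) :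
    {vspace 'rV[F]_N} :=
  (C :&: galois_dual p e C)%VS.

Definition hamming_dist (F : finFieldType) (N : nat) (x y : 'rV[F]_N) : nat :=
  #|[set i | x 0 i != y 0 i]|.

(* No d qualifies for the zero code. *)
Definition is_min_dist (F : finFieldType) (N : nat) (C : {vspace 'rV[F]_N}) (d : nat) :
    Prop :=
  (exists x y, [/\ x \in C, y \in C, x != y & hamming_dist x y = d]) /\
  (forall x y, x \in C -> y \in C -> x != y -> (d <= hamming_dist x y)%N).

Definition MDS (F : finFieldType) (N : nat) (C : {vspace 'rV[F]_N}) : Prop :=
  is_min_dist C (N - \dim C + 1).

(* {poly_k F} is the space of polynomials of size at most k, i.e. of degree at
   most k - 1. *)
Definition grs_word (F : finFieldType) (n k : nat) (a v : 'rV[F]_n)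
    (f : {poly_k F}) : 'rV[F]_n :=
  \row_i (v 0 i * (f : {poly F}).[a 0 i]).

Fact grs_word_is_linear (F : finFieldType) (n k : nat) (a v : 'rV[F]_n) :
  linear (@grs_word F n k a v).
Proof.
by move=> b f g; apply/rowP=> i; rewrite !mxE /= hornerD hornerZ mulrDr mulrCA.
Qed.

HB.instance Definition _ (F : finFieldType) (n k : nat) (a v : 'rV[F]_n) :=
  GRing.isLinear.Build F {poly_k F} 'rV[F]_n *:%R (@grs_word F n k a v)
    (@grs_word_is_linear F n k a v).

Definition GRS (F : finFieldType) (n k : nat) (a v : 'rV[F]_n) : {vspace 'rV[F]_n} :=
  limg (linfun (@grs_word F n k a v)).

Lemma GRSP (F : finFieldType) (n k : nat) (a v c : 'rV[F]_n) :
  reflect (exists2 f : {poly F}, (size f <= k)%N & c = \row_i (v 0 i * f.[a 0 i]))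
          (c \in GRS k a v).
Proof.
apply: (iffP memv_imgP) => [[f _ ->] | [f sf ->]].
  by exists (f : {poly F}); rewrite ?lfunE ?size_npoly.
by exists (npolyp k f); rewrite ?memvf // lfunE /= /grs_word npolypK.
Qed.

(* For k = 0 only f = 0 occurs, so the last coordinate is 0 although k.-1 = 0. *)
Definition grs_inf_word (F : finFieldType) (n k : nat) (a v : 'rV[F]_n)
    (f : {poly_k F}) : 'rV[F]_(n + 1) :=
  row_mx (grs_word a v f) (const_mx (f : {poly F})`_k.-1).

Fact grs_inf_word_is_linear (F : finFieldType) (n k : nat) (a v : 'rV[F]_n) :
  linear (@grs_inf_word F n k a v).
Proof.
move=> b f g; rewrite /grs_inf_word linearP scale_row_mx add_row_mx.
by congr row_mx; apply/rowP=> i; rewrite !mxE /= coefD coefZ.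
Qed.

HB.instance Definition _ (F : finFieldType) (n k : nat) (a v : 'rV[F]_n) :=
  GRing.isLinear.Build F {poly_k F} 'rV[F]_(n + 1) *:%R (@grs_inf_word F n k a v)
    (@grs_inf_word_is_linear F n k a v).

Definition GRS_inf (F : finFieldType) (n k : nat) (a v : 'rV[F]_n) :
    {vspace 'rV[F]_(n + 1)} :=
  limg (linfun (@grs_inf_word F n k a v)).

Lemma GRS_infP (F : finFieldType) (n k : nat) (a v : 'rV[F]_n) (c : 'rV[F]_(n + 1)) :
  reflect (exists2 f : {poly F}, (size f <= k)%N &
             c = row_mx (\row_i (v 0 i * f.[a 0 i])) (const_mx f`_k.-1))
          (c \in GRS_inf k a v).
Proof.
apply: (iffP memv_imgP) => [[f _ ->] | [f sf ->]].
  by exists (f : {poly F}); rewrite ?lfunE ?size_npoly.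
by exists (npolyp k f); rewrite ?memvf // lfunE /= /grs_inf_word /grs_word npolypK.
Qed.

Definition grs_u (F : finFieldType) (n : nat) (a : 'rV[F]_n) (i : 'I_n) : F :=
  \prod_(j < n | j != i) (a 0 i - a 0 j)^-1.

(* Here #|F| = p ^ h with h even, so p ^ h./2 is the square root of #|F|, and
   hx is monic, so its degree is (size hx).-1. *)
Definition hermitian_poly (F : finFieldType) (n p h m : nat) (a v : 'rV[F]_n)
    (hx : {poly F}) : Prop :=
  [/\ hx \is monic,
      ((size hx).-1 + m + 1 <= n)%N &
      exists2 lambda : F, lambda != 0 &
        forall i, lambda * grs_u a i * hx.[a 0 i] = v 0 i ^+ (p ^ h./2 + 1)].

(* Main.v *)
(* Since h / gcd(e', h) is odd, gcd(p^e' + 1, q - 1) divides 2.  As sqrt q + 1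
   is even, v_i^(sqrt q + 1) is a square, hence a (p^e' + 1)-th power
   w_i^(p^e' + 1).  Lagrange interpolation gives \sum_i u_i f(a_i) = 0 whenever
   deg f <= n - 2, so the bound on k makes GRS_k(a, w) self-orthogonal for the
   e'-Galois product.  Multiplying w_i, for i in a set S, by some alpha with
   alpha^(p^e' + 1) <> 1 turns that product on the code into a diagonal form
   supported on S (on S and the point at infinity for the extended code).  In an
   MDS code of dimension k any k coordinates are independent, so the hull
   consists of the codewords vanishing on the support, and has dimension k
   minus the size of the support. *)

Require Import Defs.
From HB Require Import structures.
From mathcomp Require Import all_boot all_order all_algebra all_field ring zify.
Import GRing.Theory.
Local Open Scope ring_scope.

(** * Powers in finite fields *)

(** Modulo x + 1, x is -1, and so is every odd power of it. The induction passes from r to r + 2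
    through x^2 = 1 + (x - 1)(x + 1), which in [nat] needs x positive; x = 0 is treated apart. *)
Lemma dvdn_add1_expn (x r : nat) : odd r -> (x + 1 %| x ^ r + 1)%N.
Proof.
move=> ro; rewrite -[r]odd_double_half {}ro; elim: (r./2) => [|m IHm]; first by rewrite expn1 dvdnn.
have D : (x + 1 %| x ^ 2 * (x ^ (1 + m.*2) + 1))%N by rewrite dvdn_mull.
have E : (x ^ 2 * (x ^ (1 + m.*2) + 1) = (x ^ 2 + x * x ^ (1 + m.*2).+1))%N.
  by rewrite mulnDr muln1 addnC (expnS x (1 + _)) (mulnA x) mulnn.
case: x => [|x] in IHm D E *; first by rewrite dvd1n.
rewrite (_ : (true + m.+1.*2 = (1 + m.*2).+2)%N); last by rewrite doubleS !addnS.
rewrite (expnS _ (1 + m.*2).+1).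
have E2 : (x.+1 ^ 2 = 1 + x * (x.+1 + 1))%N by rewrite -mulnn -(addn1 x); ring.
by move: D; rewrite E E2 addnAC dvdn_addl ?dvdn_mull // [X in (_ %| X)%N]addnC.
Qed.

(** Put r = h / gcd(e, h). As r is odd, p^(er) is -1 modulo p^e + 1; as er is a multiple of h, it is
    1 modulo p^h - 1. Modulo the gcd both hold, so the gcd divides 2. *)
Lemma gcdn_expn_add1_sub1 (p e h : nat) :
  (0 < p)%N -> (0 < h)%N -> odd (h %/ gcdn e h) ->
  (gcdn (p ^ e + 1) (p ^ h - 1) %| 2)%N.
Proof.
move=> p0 h0 ro; set d := gcdn _ _.
have g0 : (0 < gcdn e h)%N by rewrite gcdn_gt0 h0 orbT.
set r := (h %/ gcdn e h)%N in ro; set t := (e %/ gcdn e h)%N.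
have er : (e * r = h * t)%N.
  by rewrite -[e in LHS](divnK (dvdn_gcdl e h)) -[h in RHS](divnK (dvdn_gcdr e h)) -/r -/t mulnAC (mulnC t r) mulnAC.
have D1 : (d %| p ^ (e * r) + 1)%N.
  by rewrite expnM (dvdn_trans (dvdn_gcdl _ _)) ?dvdn_add1_expn.
have D2 : (d %| p ^ (e * r) - 1)%N.
  by rewrite er (dvdn_trans (dvdn_gcdr _ _)) // !subn1 expnM dvdn_pred_predX.
have E : (p ^ (e * r) + 1 = (p ^ (e * r) - 1) + 2)%N.
  by rewrite -[in LHS](@subnK 1 (p ^ (e * r))) ?expn_gt0 ?p0 // -addnA.
by move: D1; rewrite E dvdn_addr.
Qed.

Lemma expf_card_pred (F : finFieldType) (x : F) : x != 0 -> x ^+ (#|F| - 1) = 1.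
Proof.
move=> x0; apply: (mulfI x0); rewrite -exprS mulr1 subn1 prednK ?expf_card //.
by apply/card_gt0P; exists x.
Qed.

(** Bezout's identity in the exponent, combined with x^(q-1) = 1. The root is given as a power of x
    so that x^m = 1 forces x^d = 1. *)
Lemma expf_gcdn_root (F : finFieldType) (x : F) (m d : nat) :
  (gcdn m (#|F| - 1) %| d)%N -> (0 < m)%N -> x != 0 -> exists u, x ^+ d = (x ^+ u) ^+ m.
Proof.
move=> /dvdnP[t ->] m0 x0; case: (egcdnP (#|F| - 1) m0) => km kn E _.
exists (km * t)%N; rewrite -exprM mulnAC E mulnDl exprD -mulnA mulnCA (exprM x (#|F| - 1)).
by rewrite expf_card_pred // expr1n mul1r mulnC.
Qed.

(** If x^m = 1, then x^2, being a power of x^m, is 1, so x is 1 or -1; a field of more than three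
    elements has another nonzero x. *)
Lemma exists_expf_neq1 (F : finFieldType) (m : nat) :
  (3 < #|F|)%N -> (0 < m)%N -> (gcdn m (#|F| - 1) %| 2)%N ->
  exists2 x : F, x != 0 & x ^+ m != 1.
Proof.
move=> F3 m0 G.
have [x] : exists x : F, x \notin [set 0; 1; -1].
  apply/existsP; apply: contraLR F3; rewrite negb_exists => /forallP H.
  rewrite -leqNgt -cardsT (leq_trans (subset_leq_card (B := [set 0; 1; -1 : F]) _)) //.
    by apply/subsetP=> x _; move: (H x); rewrite negbK.
  by rewrite setUC cardsU1 cards2; case: (_ \notin _); case: (_ != _).
rewrite !inE !negb_or => /andP[/andP[x0 x1] xN1]; exists x => //.
apply: contraNneq x1 => xm.
have [u] := expf_gcdn_root _ _ _ _ G m0 x0.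
by rewrite -exprM mulnC exprM xm expr1n => /eqP; rewrite sqrf_eq1 (negPf xN1) orbF.
Qed.

(** * Hulls of MDS codes *)

Lemma exists_card_set (T : finType) (s : nat) :
  (s <= #|T|)%N -> exists S : {set T}, #|S| = s.
Proof.
by case/card_geqP=> r [ur sr _]; exists [set i in r]; rewrite cardsE (card_uniqP ur).
Qed.

Section Vanish.
Variables (F : finFieldType) (N : nat).
Implicit Types (C U : {vspace 'rV[F]_N}) (S : {set 'I_N}) (c : 'rV[F]_N).

(** Encoded as the kernel of the restriction to the coordinates in S, so that rank-nullity bounds
    the loss of dimension. *)
Definition vanishing S : {vspace 'rV[F]_N} :=
  lker (linfun (colsub (enum_val (A := S)))).

Lemma vanishingP S c : reflect {in S, forall i, c 0 i = 0} (c \in vanishing S).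
Proof.
rewrite memv_ker lfunE; apply: (iffP eqP) => [/rowP E i iS | E].
  by have := E (enum_rank_in iS i); rewrite !mxE enum_rankK_in.
by apply/rowP=> j; rewrite !mxE E ?enum_valP.
Qed.

Lemma dim_cap_vanishing U S : (\dim U <= \dim (U :&: vanishing S) + #|S|)%N.
Proof.
rewrite -(limg_ker_dim (linfun (colsub (enum_val (A := S)))) U) leq_add2l.
by rewrite (leq_trans (dimvS (subvf _))) // dimvf /= /dim /= mul1n.
Qed.

Definition zero_set c := [set i | c 0 i == 0].

Lemma cap_vanishingU U S T :
  (U :&: vanishing (S :|: T) = (U :&: vanishing S) :&: vanishing T)%VS.
Proof.
apply/vspaceP=> c; rewrite !memv_cap -andbA; congr (_ && _).
apply/vanishingP/andP => [H | [/vanishingP HS /vanishingP HT] i].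
  by split; apply/vanishingP=> i iS; apply: H; rewrite inE iS ?orbT.
by rewrite inE => /orP[/HS|/HT].
Qed.

Variable C : {vspace 'rV[F]_N}.
Hypothesis dimC : (\dim C <= N)%N.
Hypothesis zerosC : forall c, c \in C -> c != 0 -> (#|zero_set c| < \dim C)%N.

(** Rank-nullity gives one inequality. For the other, a set T disjoint from S completes it to dim C
    positions. By [zerosC] only 0 vanishes on all of them, so imposing zeros on T kills the
    remaining space, whose dimension is then at most |T|. *)
Lemma dim_vanishing S : (#|S| <= \dim C)%N -> \dim (C :&: vanishing S) = (\dim C - #|S|)%N.
Proof.
move=> Sk; apply/eqP; rewrite eqn_leq leq_subLR addnC dim_cap_vanishing andbT.
have : (\dim C - #|S| <= #|~: S|)%N.
  by rewrite leq_subLR cardsC card_ord.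
case/card_geqP => s [us ss sS]; pose T := [set i in s].
have cT : #|T| = (\dim C - #|S|)%N by rewrite cardsE (card_uniqP us).
have E : (C :&: vanishing (S :|: T) = 0)%VS.
  apply/eqP; rewrite -subv0; apply/subvP=> c; rewrite memv_cap memv0.
  case/andP=> cC /vanishingP cST; apply: contraT => c0.
  have := zerosC _ cC c0; rewrite ltnNge => /negP[].
  rewrite -(subnKC Sk) -cT -[(_ + _)%N]subn0 -(cards0 'I_N).
  have <- : S :&: T = set0.
    by apply/setP=> i; rewrite !inE andbC; apply/negP=> /andP[/sS]; rewrite inE => /negPf->.
  rewrite -cardsU; apply/subset_leq_card/subsetP=> i /cST ci.
  by rewrite inE ci.
by rewrite -cT (leq_trans (dim_cap_vanishing _ T)) // -cap_vanishingU E dimv0.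
Qed.

(** By [dim_vanishing], dropping i from S strictly enlarges the space of codewords that vanish
    there; any new one is nonzero at i. *)
Lemma exists_vanishing_except S i : (#|S| <= \dim C)%N -> i \in S ->
  exists2 c, c \in C & c 0 i != 0 /\ {in S :\ i, forall j, c 0 j = 0}.
Proof.
move=> Sk iS; have Sk' : (#|S :\ i| <= \dim C)%N.
  by rewrite (leq_trans _ Sk) ?subset_leq_card ?subsetDl.
have : ~~ (C :&: vanishing (S :\ i) <= C :&: vanishing S)%VS.
  apply/negP=> /dimvS; rewrite !dim_vanishing //.
  by move: Sk; rewrite (cardsD1 i S) iS; lia.
case/subvPn=> c; rewrite !memv_cap => /andP[cC /vanishingP cSi].
rewrite cC /= => ncS; exists c => //; split=> //; apply: contra ncS => /eqP ci.
apply/vanishingP=> j jS; have [->//|ji] := eqVneq j i.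
by apply: cSi; rewrite !inE ji.
Qed.

Lemma hamming_distE x y : hamming_dist x y = (N - #|zero_set (x - y)|)%N.
Proof.
have -> : hamming_dist x y = #|~: zero_set (x - y)|.
  by apply: eq_card => i; rewrite !inE !mxE subr_eq0.
by rewrite cardsCs setCK card_ord.
Qed.

(** A nonzero difference of codewords has at most dim C - 1 zeros, which bounds the distance from
    below; a nonzero codeword vanishing on dim C - 1 chosen positions attains the bound. *)
Lemma MDS_of_zeros : (0 < \dim C)%N -> MDS C.
Proof.
move=> C0; have W x y : x \in C -> y \in C -> x != y -> (N - \dim C + 1 <= hamming_dist x y)%N.
  move=> xC yC xy; rewrite hamming_distE addn1 ltn_sub2l //; last first.
    by rewrite zerosC ?rpredB ?subr_eq0.
  by rewrite (leq_trans _ dimC) // zerosC ?rpredB ?subr_eq0.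
split=> //; have [T cT] : exists T : {set 'I_N}, #|T| = (\dim C).-1.
  by apply: exists_card_set; rewrite card_ord (leq_trans (leq_pred _)).
have : (C :&: vanishing T)%VS != 0%VS.
  by rewrite -dimv_eq0 dim_vanishing cT ?leq_pred // -lt0n subn_gt0 prednK.
rewrite -subv0 => /subvPn[c]; rewrite memv_cap memv0 => /andP[cC /vanishingP cT0] c0.
exists c, 0; split; rewrite ?mem0v //; apply/eqP; rewrite eqn_leq W ?mem0v // andbT.
rewrite hamming_distE subr0 addn1 -subSn // -[X in (_ <= _ - X)%N](prednK C0) subSS leq_sub2l // -cT.
by apply/subset_leq_card/subsetP=> i /cT0 ci; rewrite inE ci.
Qed.

(** For i in the support of d, a codeword nonzero at i and zero on the rest of the support isolates
    the i-th term, so orthogonality to it forces c_i = 0. The hull is thus the subcode vanishing on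
    the support. *)
Lemma dim_hull_diagonal (p e : nat) (d : 'rV[F]_N) :
  (#|[set i | d 0%R i != 0%R]| <= \dim C)%N ->
  {in C &, forall c1 c2, galois_inner p e c1 c2 = \sum_i d 0 i * (c1 0 i * c2 0 i ^+ (p ^ e))} ->
  (0 < p)%N ->
  \dim (galois_hull p e C) = (\dim C - #|[set i | d 0%R i != 0%R]|)%N.
Proof.
set S := [set _ | _] => Sk innerE p0; rewrite -dim_vanishing //; congr (\dim _).
apply/vspaceP=> c; rewrite !memv_cap; case cC: (c \in C) => //=.
apply/galois_dualP/vanishingP=> [H i iS | H c2 c2C].
  have [c2 c2C [c2i c2S]] := exists_vanishing_except _ _ Sk iS.
  move: (H _ c2C); rewrite innerE // (bigD1 i) //= big1 ?addr0.
    by move/eqP; rewrite !mulf_eq0 expf_eq0 (negPf c2i) andbF orbF; move: iS; rewrite inE => /negPf-> /eqP.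
  move=> j ji; have [jS|] := boolP (j \in S); last first.
    by rewrite inE negbK => /eqP->; rewrite mul0r.
  by rewrite (c2S j) ?in_setD1 ?ji // expr0n expn_eq0 (gtn_eqF p0) !mulr0.
rewrite innerE // big1 // => i _; have [iS|] := boolP (i \in S); first by rewrite H // mul0r mulr0.
by rewrite inE negbK => /eqP->; rewrite mul0r.
Qed.

End Vanish.

Arguments zero_set {F N} c.

(** * Generalized Reed-Solomon codes *)

Lemma card_ord_split (m n : nat) (P : pred 'I_(m + n)) :
  #|[set i | P i]| = (#|[set i | P (lshift n i)]| + #|[set i | P (rshift m i)]|)%N.
Proof.
rewrite !cardsE -!sum1_card big_mkcond big_split_ord.
by congr (_ + _)%N; rewrite [RHS]big_mkcond.
Qed.

Section GRSCodes.
Variables (F : finFieldType) (n : nat) (a : 'rV[F]_n).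
Hypothesis a_inj : injective (fun i => a 0 i).
Implicit Types (f g hx : {poly F}) (v w : 'rV[F]_n) (S : {set 'I_n}).

Lemma card_root_set f : f != 0 -> (#|[set i | f.[a 0%R i] == 0%R]| < size f)%N.
Proof.
move=> f0; rewrite cardE -(size_map (fun i => a 0 i)); apply: max_poly_roots => //.
  by apply/allP=> x /mapP[i]; rewrite mem_enum inE => ri ->; apply: ri.
by rewrite map_inj_uniq // enum_uniq.
Qed.

Lemma poly_eq0_on_points f :
  (size f <= n)%N -> (forall i, f.[a 0 i] = 0) -> f = 0.
Proof.
move=> sf f0; apply/eqP; apply: contraLR sf => /card_root_set.
rewrite -ltnNge; have -> : [set i | f.[a 0 i] == 0] = setT.
  by apply/setP=> i; rewrite !inE f0 eqxx.
by rewrite cardsT card_ord.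
Qed.

(** The Lagrange basis polynomial before normalisation: monic of degree n - 1, with value 1/u_i at
    a_i. *)
Definition nodal_poly (i : 'I_n) : {poly F} := \prod_(j < n | j != i) ('X - (a 0 j)%:P).

Lemma horner_nodal i j :
  (nodal_poly i).[a 0 j] = if j == i then (grs_u a i)^-1 else 0.
Proof.
rewrite /nodal_poly horner_prod; case: eqVneq => [->|ji].
  rewrite /grs_u -prodfV; apply: eq_bigr => l _.
  by rewrite invrK hornerXsubC.
by rewrite (bigD1 j) //= hornerXsubC subrr mul0r.
Qed.

Lemma size_nodal i : size (nodal_poly i) = n.
Proof.
rewrite /nodal_poly -big_filter size_prod_XsubC.
rewrite (_ : size _ = #|predC1 i|); last by rewrite cardE /enum_mem.
by rewrite cardC1 card_ord prednK // (leq_ltn_trans _ (ltn_ord i)).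
Qed.

Lemma coef_nodal i : (nodal_poly i)`_n.-1 = 1.
Proof.
by rewrite -[X in X.-1](size_nodal i) -/(lead_coef _); apply/monicP/monic_prod_XsubC.
Qed.

Lemma grs_u_neq0 i : grs_u a i != 0.
Proof.
apply/prodf_neq0=> j ji; rewrite invr_eq0 subr_eq0.
by apply: contra ji => /eqP/a_inj->.
Qed.

Lemma sum_nodal_horner (c : 'I_n -> F) j :
  (\sum_i c i *: nodal_poly i).[a 0 j] = c j / grs_u a j.
Proof.
rewrite horner_sum (bigD1 j) //= big1 ?addr0 => [|i ij].
  by rewrite hornerZ horner_nodal eqxx.
by rewrite hornerZ horner_nodal eq_sym (negPf ij) mulr0.
Qed.

Lemma size_sum_nodal (c : 'I_n -> F) : (size (\sum_i c i *: nodal_poly i)%R <= n)%N.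
Proof.
apply/leq_sizeP=> j nj; rewrite coef_sum big1 // => i _.
by rewrite coefZ nth_default ?mulr0 ?size_nodal.
Qed.

(* By Lagrange interpolation f = \sum_i u_i f(a_i) \prod_(j != i) (x - a_j). *)
Lemma sum_grs_u f : (size f <= n)%N -> \sum_i grs_u a i * f.[a 0 i] = f`_n.-1.
Proof.
move=> sf; set c := fun i => grs_u a i * f.[a 0 i].
have -> : f = \sum_i c i *: nodal_poly i.
  apply/eqP; rewrite -subr_eq0; apply/eqP/poly_eq0_on_points => [|j].
    rewrite (leq_trans (size_polyD _ _)) // size_polyN geq_max sf.
    exact: size_sum_nodal.
  by rewrite hornerD hornerN sum_nodal_horner /c mulrAC mulfV ?grs_u_neq0 // mul1r subrr.
rewrite coef_sum; apply: eq_bigr => i _; rewrite coefZ coef_nodal mulr1.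
by rewrite sum_nodal_horner mulrC divfK ?grs_u_neq0.
Qed.

Lemma sum_grs_u_eq0 f : (size f < n)%N -> \sum_i grs_u a i * f.[a 0 i] = 0.
Proof.
move=> sf; rewrite sum_grs_u 1?ltnW // nth_default //.
(* For n = 0, where [n.-1] is also 0, [sf] is absurd. *)
by case: n sf.
Qed.

(** Interpolation gives H with u_i H(a_i) = v_i^(sqrt q + 1). Were its degree too large, some x^j
    with j < m would raise it to exactly n - 1, and orthogonality to x^j would make the leading
    coefficient of H zero. That coefficient serves as lambda after normalisation. *)
Lemma hermitian_poly_exists (p h m : nat) v :
  (0 < n)%N -> (forall i, v 0 i != 0) ->
  (forall f, (size f <= m)%N -> \sum_i v 0 i ^+ (p ^ h./2 + 1) * f.[a 0 i] = 0) ->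
  exists hx, hermitian_poly p h m a v hx.
Proof.
move=> n0 v0 orth; set c := fun i => v 0 i ^+ (p ^ h./2 + 1).
set H := \sum_i c i *: nodal_poly i.
have HE i : grs_u a i * H.[a 0 i] = c i.
  by rewrite sum_nodal_horner mulrC divfK ?grs_u_neq0.
have H0 : H != 0.
  apply: contraNneq (expf_neq0 (p ^ h./2 + 1) (v0 (Ordinal n0))) => H0.
  by rewrite -/(c _) -HE H0 horner0 mulr0.
have lH : lead_coef H != 0 by rewrite lead_coef_eq0.
have sH : (0 < size H)%N by rewrite size_poly_gt0.
have sHn : (size H <= n)%N by apply: size_sum_nodal.
exists ((lead_coef H)^-1 *: H); split.
- by apply/monicP; rewrite lead_coefZ mulVf.
- rewrite size_scale ?invr_eq0 // addnAC addn1 prednK // leqNgt.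
  apply/negP=> nHm; have sj : (n - size H < m)%N by rewrite ltn_subLR // addnC.
  have := orth 'X^(n - size H); rewrite size_polyXn => /(_ sj) E.
  case/eqP: lH; rewrite -E lead_coefE.
  rewrite (eq_bigr (fun i => grs_u a i * (H * 'X^(n - size H)).[a 0 i])).
    rewrite sum_grs_u ?size_mulXn ?subnK // coefMXn ltnNge.
    rewrite (_ : (n - size H <= n.-1)%N); last by lia.
    by rewrite (_ : (n.-1 - (n - size H) = (size H).-1)%N) //; lia.
  by move=> i _; rewrite -/(c i) -HE hornerM mulrA.
exists (lead_coef H) => // i; rewrite hornerZ -mulrA (mulrCA (grs_u a i)).
by rewrite mulVKf ?HE.
Qed.

(** * Zeros and dimensions of the codes *)

Lemma GRS_zeros (k : nat) w : (forall i, w 0 i != 0) ->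
  forall c, c \in GRS k a w -> c != 0 -> (#|zero_set c| < k)%N.
Proof.
move=> w0 c /GRSP[f sf ->] c0; have f0 : f != 0.
  by apply: contraNneq c0 => ->; apply/eqP/rowP=> i; rewrite !mxE horner0 mulr0.
rewrite (leq_trans _ sf) // (leq_trans _ (card_root_set _ f0)) // ltnS.
apply/subset_leq_card/subsetP=> i; rewrite !inE mxE mulf_eq0 (negPf (w0 i)) //.
Qed.

Lemma dim_GRS (k : nat) w : (forall i, w 0 i != 0) -> (k <= n)%N -> \dim (GRS k a w) = k.
Proof.
move=> w0 kn; rewrite limg_dim_eq ?dim_polyn //; apply/eqP; rewrite -subv0.
apply/subvP=> f; rewrite memv_cap memv_ker memvf lfunE memv0 /= => /eqP/rowP fw.
apply/eqP/val_inj/poly_eq0_on_points => [|i]; first by rewrite (leq_trans (size_npoly _)).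
by have /eqP := fw i; rewrite !mxE mulf_eq0 (negPf (w0 i)) => /eqP.
Qed.

Lemma size_le_pred f (k : nat) : (size f <= k)%N -> f`_k.-1 = 0 -> (size f <= k.-1)%N.
Proof.
move=> sf fk; apply/leq_sizeP=> j; rewrite leq_eqVlt => /predU1P[<-//|kj].
by apply: nth_default; rewrite (leq_trans sf) // (leq_trans (leqSpred k)).
Qed.

(** A zero at infinity means that the coefficient of x^(k-1) vanishes; the degree bound then drops
    by one, which makes up for the additional zero. *)
Lemma GRS_inf_zeros (k : nat) w : (forall i, w 0 i != 0) ->
  forall c, c \in GRS_inf k a w -> c != 0 -> (#|zero_set c| < k)%N.
Proof.
move=> w0 c /GRS_infP[f sf ->] c0; have f0 : f != 0.
  apply: contraNneq c0 => ->; apply/eqP/rowP=> i; rewrite mxE.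
  by case: split => j; rewrite !mxE ?horner0 ?mulr0 ?coef0.
have k0 : (0 < k)%N by apply: leq_trans sf; rewrite size_poly_gt0.
rewrite /zero_set card_ord_split.
set x := row_mx _ _.
have Z : (#|[set i | x 0%R (lshift 1 i) == 0%R]| < size f)%N.
  apply: leq_trans (card_root_set _ f0); rewrite ltnS.
  apply/subset_leq_card/subsetP=> i.
  by rewrite !inE /x row_mxEl mxE mulf_eq0 (negPf (w0 i)).
case: (eqVneq f`_k.-1 0) => fk.
  rewrite -[X in (_ < X)%N](prednK k0) -[X in (_ < X)%N]addn1 -addSn leq_add //.
    exact: leq_trans Z (size_le_pred _ _ sf fk).
  by rewrite (leq_trans (max_card _)) ?card_ord.
rewrite [X in (_ + X)%N](_ : _ = 0%N) ?addn0 ?(leq_trans Z) //.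
by apply/eqP; rewrite cards_eq0; apply/eqP/setP=> i; rewrite !inE /x row_mxEr mxE (negPf fk).
Qed.

Lemma dim_GRS_inf (k : nat) w : (forall i, w 0 i != 0) -> (k <= n)%N ->
  \dim (GRS_inf k a w) = k.
Proof.
move=> w0 kn; rewrite limg_dim_eq ?dim_polyn //; apply/eqP; rewrite -subv0.
apply/subvP=> f; rewrite memv_cap memv_ker memvf lfunE memv0 /= => /eqP/rowP fw.
apply/eqP/val_inj/poly_eq0_on_points => [|i]; first by rewrite (leq_trans (size_npoly _)).
by have /eqP := fw (lshift 1 i); rewrite row_mxEl !mxE mulf_eq0 (negPf (w0 i)) => /eqP.
Qed.

(** * Twisting the multipliers on a set of coordinates *)

Section Twist.
Variables (Q k : nat) (w : 'rV[F]_n) (lambda : F) (hx : {poly F}).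
Hypothesis w_neq0 : forall i, w 0 i != 0.
Hypothesis wE : forall i, w 0 i ^+ (Q + 1) = lambda * grs_u a i * hx.[a 0 i].
Hypothesis small : ((size hx).-1 + k.-1 * (Q + 1) + 1 < n)%N.

(** By [wE] the sum is lambda times that of u_i (hx f g^Q)(a_i), and [small] keeps the degree of the
    product at most n - 2. *)
Lemma weighted_sum_eq0 f g : (size f <= k)%N -> (size g <= k)%N ->
  \sum_i w 0 i ^+ (Q + 1) * (f.[a 0 i] * g.[a 0 i] ^+ Q) = 0.
Proof.
move=> sf sg.
rewrite (eq_bigr (fun i => lambda * (grs_u a i * (hx * (f * g ^+ Q)).[a 0 i]))).
  rewrite -mulr_sumr sum_grs_u_eq0 ?mulr0 //; apply: leq_ltn_trans small.
  rewrite (leq_trans (size_polyMleq _ _)) // -subn1 leq_subLR.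
  have A : (size hx <= (size hx).-1.+1)%N by rewrite leqSpred.
  have B : (size (f * g ^+ Q)%R <= k.-1 * (Q + 1) + 1)%N.
    rewrite (leq_trans (size_polyMleq _ _)) // -subn1 leq_subLR.
    have C : (size f <= k.-1.+1)%N by rewrite (leq_trans sf) // leqSpred.
    have D : (size (g ^+ Q)%R <= (k.-1 * Q).+1)%N.
      rewrite (leq_trans (size_poly_exp_leq _ _)) // ltnS leq_mul2r.
      by rewrite -!subn1 leq_sub2r ?orbT.
    rewrite (leq_trans (leq_add C D)) // mulnDr muln1; lia.
  by rewrite (leq_trans (leq_add A B)) //; lia.
by move=> i _; rewrite wE !hornerM horner_exp !mulrA.
Qed.

Variables (alpha : F) (S : {set 'I_n}).
Hypothesis alpha_neq0 : alpha != 0.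
Hypothesis alpha_neq1 : alpha ^+ (Q + 1) != 1.

Definition twist : 'rV[F]_n := \row_i (if i \in S then alpha * w 0 i else w 0 i).

(** On S a twisted term is alpha^(Q+1) times the untwisted one. This coefficient is the fraction of
    it left after the untwisted term is subtracted. *)
Definition twist_coef : 'rV[F]_n :=
  \row_i (if i \in S then 1 - (alpha ^+ (Q + 1))^-1 else 0).

Lemma twist_neq0 i : twist 0 i != 0.
Proof. by rewrite mxE; case: ifP; rewrite ?mulf_neq0. Qed.

Lemma support_twist_coef : [set i | twist_coef 0 i != 0] = S.
Proof.
apply/setP=> i; rewrite !inE mxE; case: (i \in S); last by rewrite eqxx.
by rewrite subr_eq0 eq_sym invr_eq1.
Qed.

(** Coordinate by coordinate, the two sides differ by the untwisted term, and these terms sum to 0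
    by [weighted_sum_eq0]. *)
Lemma twisted_sum f g : (size f <= k)%N -> (size g <= k)%N ->
  let c1 := \row_i (twist 0 i * f.[a 0 i]) in
  let c2 := \row_i (twist 0 i * g.[a 0 i]) in
  \sum_i c1 0 i * c2 0 i ^+ Q = \sum_i twist_coef 0 i * (c1 0 i * c2 0 i ^+ Q).
Proof.
move=> sf sg c1 c2; apply/eqP; rewrite -subr_eq0 -sumrB.
apply/eqP; rewrite -[RHS](weighted_sum_eq0 f g) //; apply: eq_bigr => i _.
rewrite !mxE !exprMn.
have E (x : F) : x * f.[a 0 i] * (x ^+ Q * g.[a 0 i] ^+ Q) = x ^+ (Q + 1) * (f.[a 0 i] * g.[a 0 i] ^+ Q).
  by rewrite exprD expr1 mulrACA (mulrC x).
rewrite -exprMn exprMn; case: ifP => _; last by rewrite mul0r subr0 E.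
rewrite E exprMn mulrBl mul1r opprB addrCA subrr addr0 -mulrA mulKf //.
by rewrite expf_neq0.
Qed.

End Twist.
End GRSCodes.

(** * Codes with a prescribed hull dimension *)

Section Codes.
Variables (F : finFieldType) (p e n k : nat) (a w : 'rV[F]_n) (lambda alpha : F).
Variable hx : {poly F}.
Hypothesis a_inj : injective (fun i => a 0 i).
Hypothesis p_gt0 : (0 < p)%N.
Hypothesis k_gt0 : (0 < k)%N.
Hypothesis w_neq0 : forall i, w 0 i != 0.
Hypothesis wE : forall i, w 0 i ^+ (p ^ e + 1) = lambda * grs_u a i * hx.[a 0 i].
Hypothesis small : ((size hx).-1 + k.-1 * (p ^ e + 1) + 1 < n)%N.
Hypothesis alpha_neq0 : alpha != 0.
Hypothesis alpha_neq1 : alpha ^+ (p ^ e + 1) != 1.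

Let kn : (k <= n)%N.
Proof. by move: small; rewrite mulnDr muln1; lia. Qed.

(** Twisting on k - l coordinates leaves a hull of dimension k - (k - l) = l. *)
Lemma exists_GRS_hull (l : nat) : (l <= k)%N ->
  exists C : {vspace 'rV[F]_n}, [/\ \dim C = k, MDS C & \dim (galois_hull p e C) = l].
Proof.
move=> lk; have [|S cS] := exists_card_set 'I_n (k - l).
  by rewrite card_ord (leq_trans (leq_subr _ _)).
have w'0 := twist_neq0 _ _ w w_neq0 alpha S alpha_neq0.
set w' := twist _ _ _ _ _ in w'0.
have dimC : \dim (GRS k a w') = k by rewrite dim_GRS.
have zerosC c : c \in GRS k a w' -> c != 0 -> (#|zero_set c| < \dim (GRS k a w'))%N.
  by rewrite dimC; apply: GRS_zeros.
exists (GRS k a w'); split; rewrite ?dimC //.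
  by apply: MDS_of_zeros => //; rewrite dimC.
rewrite (@dim_hull_diagonal _ _ _ _ zerosC _ _ (twist_coef F n (p ^ e) alpha S)) ?dimC //.
- by rewrite support_twist_coef // cS subKn.
- by rewrite support_twist_coef // cS leq_subr.
move=> c1 c2 /GRSP[f sf ->] /GRSP[g sg ->].
exact: (twisted_sum _ _ _ a_inj _ _ _ _ _ wE small).
Qed.

(** The product at infinity is not cancelled and enters the diagonal form with coefficient 1.
    Infinity thus always belongs to the support, so only k - 1 - l finite coordinates are twisted,
    whence the bound on l. *)
Lemma exists_GRS_inf_hull (l : nat) : (l <= k - 1)%N ->
  exists C : {vspace 'rV[F]_(n + 1)}, [/\ \dim C = k, MDS C & \dim (galois_hull p e C) = l].
Proof.
move=> lk; have [|S cS] := exists_card_set 'I_n (k - 1 - l).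
  by rewrite card_ord (leq_trans (leq_subr _ _)) // (leq_trans (leq_subr _ _)).
have w'0 := twist_neq0 _ _ w w_neq0 alpha S alpha_neq0.
set w' := twist _ _ _ _ _ in w'0.
have dimC : \dim (GRS_inf k a w') = k by rewrite dim_GRS_inf.
have kn1 : (k <= n + 1)%N by rewrite addn1 leqW.
have zerosC c : c \in GRS_inf k a w' -> c != 0 -> (#|zero_set c| < \dim (GRS_inf k a w'))%N.
  by rewrite dimC; apply: GRS_inf_zeros.
pose d := row_mx (twist_coef F n (p ^ e) alpha S) (const_mx 1 : 'rV_1).
have suppd : #|[set i | d 0 i != 0]| = (k - l)%N.
  rewrite card_ord_split (_ : [set i | d 0 (lshift 1 i) != 0] = S); last first.
    rewrite -[RHS](support_twist_coef _ _ _ _ _ alpha_neq1).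
    by apply/setP=> i; rewrite !inE row_mxEl.
  rewrite (_ : [set i | d 0 (rshift n i) != 0] = setT); last first.
    by apply/setP=> i; rewrite !inE row_mxEr mxE oner_eq0.
  by rewrite cS cardsT card_ord; lia.
exists (GRS_inf k a w'); split; rewrite ?dimC //.
  by apply: MDS_of_zeros => //; rewrite dimC.
rewrite (@dim_hull_diagonal _ _ _ _ zerosC _ _ d) ?dimC ?suppd ?leq_subr //.
  by rewrite subKn // (leq_trans lk) ?leq_subr.
move=> c1 c2 /GRS_infP[f sf ->] /GRS_infP[g sg ->].
rewrite /galois_inner !big_split_ord /=; congr (_ + _).
  under eq_bigr do rewrite !row_mxEl.
  under [RHS]eq_bigr do rewrite !row_mxEl.
  exact: (twisted_sum _ _ _ a_inj _ _ _ _ _ wE small).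
by apply: eq_bigr => i _; rewrite !row_mxEr [const_mx 1 _ _]mxE mul1r.
Qed.

End Codes.

(** * The common weights and the two families of codes *)

Theorem theorem8 (F : finFieldType) (p h e' n : nat)
    (p_prime : prime p) (p_odd : odd p)
    (h_gt0 : (0 < h)%N) (h_even : ~~ odd h) (cardF : #|F| = (p ^ h)%N)
    (e'_le : (e' <= h - 1)%N) (e'_odd : odd (h %/ gcdn e' h))
    (n_gt0 : (0 < n)%N) (a v : 'rV[F]_n)
    (a_inj : injective (fun i => a 0 i)) (v_neq0 : forall i, v 0 i != 0) :
  (forall m : nat,
     (GRS m a v <= galois_dual p h./2 (GRS m a v))%VS ->
     (exists hx : {poly F}, hermitian_poly p h m a v hx) /\
     (forall hx : {poly F}, hermitian_poly p h m a v hx ->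
      forall k l : nat,
        (1 <= k)%N ->
        (k <= (p ^ e' + n - 1 - (size hx).-1) %/ (p ^ e' + 1))%N ->
        (l <= k)%N ->
        exists C : {vspace 'rV[F]_n},
          [/\ \dim C = k, MDS C & \dim (galois_hull p e' C) = l]))
  /\
  (forall m : nat, (2 <= m)%N ->
     (GRS_inf m a v <= galois_dual p h./2 (GRS_inf m a v))%VS ->
     (exists hx : {poly F}, hermitian_poly p h m a v hx) /\
     (forall hx : {poly F}, hermitian_poly p h m a v hx ->
      forall k l : nat,
        (1 <= k)%N ->
        (k <= (p ^ e' + n - 1 - (size hx).-1) %/ (p ^ e' + 1))%N ->
        (l <= k - 1)%N ->
        exists C : {vspace 'rV[F]_(n + 1)},
          [/\ \dim C = k, MDS C & \dim (galois_hull p e' C) = l])).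
Proof.
have p_gt1 := prime_gt1 p_prime; have p_gt0 := ltnW p_gt1.
have p_gt2 : (2 < p)%N by rewrite odd_prime_gt2.
have h_gt1 : (1 < h)%N by move: h_gt0 h_even; case: (h) => [|[]].
have F_gt3 : (3 < #|F|)%N.
  by rewrite cardF (leq_trans _ (leq_pexp2l p_gt0 h_gt1)) // (leq_trans _ (leq_mul p_gt2 p_gt2)).
have G : (gcdn (p ^ e' + 1) (#|F| - 1) %| 2)%N.
  by rewrite cardF gcdn_expn_add1_sub1.
have Q1 : (0 < p ^ e' + 1)%N by rewrite addn1.
have [alpha alpha0 alpha1] := exists_expf_neq1 _ _ F_gt3 Q1 G.
have [w0 w0E] : exists w0 : 'I_n -> F, forall i, v 0 i ^+ (p ^ h./2 + 1) = w0 i ^+ (p ^ e' + 1).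
  have even : odd (p ^ h./2 + 1) = false by rewrite oddD oddX p_odd orbT.
  (* The half exponent exhibits v_i^(sqrt q + 1) as a square, to which [expf_gcdn_root] applies with
     d = 2. Boolean equality allows [xchoose] to select the roots. *)
  have root i : exists x, v 0 i ^+ (p ^ h./2 + 1) == x ^+ (p ^ e' + 1).
    have y0 : v 0 i ^+ (p ^ h./2 + 1)./2 != 0 by rewrite expf_neq0.
    have [u uE] := expf_gcdn_root _ _ _ _ G Q1 y0.
    exists ((v 0 i ^+ (p ^ h./2 + 1)./2) ^+ u); rewrite -uE -exprM muln2.
    by rewrite -[X in v 0 i ^+ X]odd_double_half even.
  by exists (fun i => xchoose (root i)) => i; apply/eqP/(xchooseP (root i)).
pose w : 'rV[F]_n := \row_i w0 i.
have w_neq0 i : w 0 i != 0.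
  apply: contra_neq (expf_neq0 (p ^ h./2 + 1) (v_neq0 i)); rewrite mxE w0E => ->.
  by rewrite expr0n addn1.
have small m hx k : hermitian_poly p h m a v hx -> (1 <= k)%N ->
    (k <= (p ^ e' + n - 1 - (size hx).-1) %/ (p ^ e' + 1))%N ->
    ((size hx).-1 + k.-1 * (p ^ e' + 1) + 1 < n)%N.
  (* Removing p^e' + 1 from both sides of k(p^e' + 1) <= p^e' + n - 1 - deg hx leaves (k - 1)(p^e' +
     1) <= n - 2 - deg hx. By [dm], deg hx < n, so the truncated subtraction in the bound is
     exact. *)
  case=> _ dm _ k0; rewrite leq_divRL // -[X in (X * _)%N](prednK k0) mulSn; lia.
have weights m hx : hermitian_poly p h m a v hx ->
    exists lambda, forall i, w 0 i ^+ (p ^ e' + 1) = lambda * grs_u a i * hx.[a 0 i].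
  by case=> _ _ [lambda _ lE]; exists lambda => i; rewrite lE mxE w0E.
split=> m.
  move=> orth; split=> [|hx Hhx k l k0 kb lk]; last first.
    have [lambda lE] := weights _ _ Hhx.
    exact: (exists_GRS_hull _ _ _ _ _ _ _ _ _ _ a_inj p_gt0 k0 w_neq0 lE (small _ _ _ Hhx k0 kb)
              alpha0 alpha1).
  apply: hermitian_poly_exists => // f sf; case: m orth sf => [|m] orth sf.
    move: sf; rewrite leqn0 size_poly_eq0 => /eqP->.
    by rewrite big1 // => i _; rewrite horner0 mulr0.
  have fC : \row_i (v 0 i * f.[a 0 i]) \in GRS m.+1 a v by apply/GRSP; exists f.
  have oneC : v \in GRS m.+1 a v.
    by apply/GRSP; exists 1; rewrite ?size_poly1 //; apply/rowP=> i; rewrite mxE hornerC mulr1.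
  have /galois_dualP/(_ _ oneC) E := subvP orth _ fC.
  rewrite -[RHS]E.
  by apply: eq_bigr => i _; rewrite mxE exprD expr1 -mulrA mulrC.
move=> m2 orth; split=> [|hx Hhx k l k0 kb lk]; last first.
  have [lambda lE] := weights _ _ Hhx.
  exact: (exists_GRS_inf_hull _ _ _ _ _ _ _ _ _ _ a_inj p_gt0 k0 w_neq0 lE (small _ _ _ Hhx k0 kb)
            alpha0 alpha1).
apply: hermitian_poly_exists => // f sf.
have fC : row_mx (\row_i (v 0 i * f.[a 0 i])) (const_mx f`_m.-1) \in GRS_inf m a v.
  by apply/GRS_infP; exists f.
(* As m >= 2, the constant 1 has coefficient 0 at x^(m-1), so its word is v followed by 0 and
   pairing with it sees only the finite coordinates. *)
have oneC : row_mx v 0 \in GRS_inf m a v.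
  apply/GRS_infP; exists 1; first by rewrite size_poly1 ltnW.
  congr row_mx; apply/rowP=> i; rewrite !mxE ?hornerC ?mulr1 // coef1.
  by case: m m2 {orth fC sf} => [|[]].
have /galois_dualP/(_ _ oneC) := subvP orth _ fC.
rewrite /galois_inner big_split_ord /= [X in _ + X]big1 ?addr0.
  move=> E; rewrite -[RHS]E; apply: eq_bigr => i _.
  by rewrite !row_mxEl mxE exprD expr1 -mulrA mulrC.
by move=> i _; rewrite !row_mxEr !mxE expr0n expn_eq0 gtn_eqF // mulr0.
Qed.
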